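(* If $G$ is a triangle-critical claw-free graph with chromatic number $8$, then $G \cong K_8$.
   Context: All graphs are finite and simple. A graph is claw-free if it has no induced subgraph isomorphic to $K_{1,3}$. For $\ell \geq 2$, a graph $G$ is called $K_{\ell}$-critical if (i) $G$ contains $K_{\ell}$ as a subgraph; (ii) $G$ is critical, i.e. removing any vertex reduces the chromatic number of $G$ by one; (iii) removing the vertex set of any copy of $K_{\ell}$ in $G$ reduces the chromatic number of $G$ by exactly $\ell$. A graph is triangle-critical if it is $K_3$-critical. *)

(* Defs.v *)
From mathcomp Require Import all_boot.

Set Implicit Arguments.
Unset Strict Implicit.
Unset Printing Implicit Defensive.

Record sgraph := SGraph {
  vertex :> finType;
  edge : rel vertex;
  edge_sym : symmetric edge;
  edge_irr : irreflexive edge }.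

Definition isomorphic (G H : sgraph) : Prop :=
  exists2 f : G -> H, bijective f & forall x y, edge (f x) (f y) = edge x y.

Section Induced.
Variables (G : sgraph) (A : {set G}).

Definition induced_edge : rel {x : G | x \in A} :=
  fun x y => edge (val x) (val y).

Lemma induced_sym : symmetric induced_edge.
Proof. by move=> x y; rewrite /induced_edge edge_sym. Qed.

Lemma induced_irr : irreflexive induced_edge.
Proof. by move=> x; rewrite /induced_edge edge_irr. Qed.

Definition induced : sgraph := SGraph induced_sym induced_irr.
End Induced.

Definition delete (G : sgraph) (A : {set G}) : sgraph := induced (~: A).

Section Complete.
Variable n : nat.

Definition complete_edge : rel 'I_n := fun i j => i != j.

Lemma complete_sym : symmetric complete_edge.
Proof. by move=> i j; rewrite /complete_edge eq_sym. Qed.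

Lemma complete_irr : irreflexive complete_edge.
Proof. by move=> i; rewrite /complete_edge eqxx. Qed.

Definition complete : sgraph := SGraph complete_sym complete_irr.
End Complete.

Section CompleteBipartite.
Variables m n : nat.

Definition biclique_edge : rel ('I_m + 'I_n)%type := fun u v =>
  match u, v with
  | inl _, inr _ | inr _, inl _ => true
  | _, _ => false
  end.

Lemma biclique_sym : symmetric biclique_edge.
Proof. by case=> ? []. Qed.

Lemma biclique_irr : irreflexive biclique_edge.
Proof. by case. Qed.

Definition biclique : sgraph := SGraph biclique_sym biclique_irr.
End CompleteBipartite.

Definition claw_free (G : sgraph) : Prop :=
  ~ exists A : {set G}, isomorphic (induced A) (biclique 1 3).

(* Not necessarily induced. *)
Definition embedding (H G : sgraph) (f : H -> G) : Prop :=
  injective f /\ forall x y, edge x y -> edge (f x) (f y).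

Definition contains (G H : sgraph) : Prop := exists f : H -> G, embedding f.

Definition colorable (G : sgraph) (k : nat) : bool :=
  [exists c : {ffun G -> 'I_k}, forall x, forall y, edge x y ==> (c x != c y)].

Lemma colorable_card (G : sgraph) : exists k, colorable G k.
Proof.
exists #|G|; apply/existsP; exists [ffun x => enum_rank x].
apply/forallP=> x; apply/forallP=> y; apply/implyP=> exy; rewrite !ffunE.
by apply: contraTneq exy => /enum_rank_inj ->; rewrite edge_irr.
Qed.

Definition chromatic (G : sgraph) : nat := ex_minn (colorable_card G).

Definition critical (G : sgraph) : Prop :=
  forall x : G, chromatic (delete [set x]) + 1 = chromatic G.

(* Used for l >= 2.  The vertex set of a copy of K_l is the image of an
   embedding of K_l; drops are written additively to avoid truncation. *)
Definition complete_critical (l : nat) (G : sgraph) : Prop :=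
  [/\ contains G (complete l),
      critical G
    & forall f : complete l -> G, embedding f ->
        chromatic (delete (f @: [set: complete l])) + l = chromatic G].

Definition triangle_critical (G : sgraph) : Prop := complete_critical 3 G.

(* Main.v *)
Require Import Defs.
From mathcomp Require Import all_boot zify.

(* Every triangle has at least five common neighbours.  Since G is claw-free,
   non-adjacency is triangle-free on the common neighbourhood of the endpoints
   of an edge in a triangle; a Ramsey-type count there yields a K_4, hence a
   K_6, say K, in G.  A triangle disjoint from K would leave a K_6 in a
   5-colourable graph, so G - K is triangle-free and, being claw-free, has
   maximum degree at most 2; as all degrees are at least 7, each vertex outside
   K has at least five neighbours in K.  An edge outside K is therefore in a
   triangle, so it has at least six common neighbours, all in K, and G contains
   K_8, which is all of G by criticality.  If there is no edge outside K, then
   G is 7-colourable. *)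

Set Implicit Arguments.
Unset Strict Implicit.
Unset Printing Implicit Defensive.

(** * Stable sets in triangle-free symmetric relations *)

Section TriangleFree.
Variables (T : finType) (h : rel T).
Hypothesis hS : symmetric h.
Implicit Types (S A : {set T}) (u v w z : T).

Definition nbh S z := [set u in S | h z u].
Definition far S z := [set u in S | (u != z) && ~~ h z u].
Definition stable A := {in A &, forall u v, ~~ h u v}.
Definition triangle_free S :=
  {in S & &, forall u v w, h u v -> h v w -> ~~ h u w}.
Definition has_stable S m := exists2 A : {set T}, A \subset S & stable A /\ m <= #|A|.

Hypothesis hI : irreflexive h.

Lemma card_nbh_far S z : z \in S -> #|S| = #|nbh S z| + #|far S z| + 1.
Proof.
move=> zS; rewrite (cardsD1 z) zS -(cardsID [set u | h z u] (S :\ z)).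
have -> : (S :\ z) :&: [set u | h z u] = nbh S z.
  apply/setP=> u; rewrite !inE; case: (eqVneq u z) => [->|] //=.
  by rewrite hI andbF.
have -> : (S :\ z) :\: [set u | h z u] = far S z.
  by apply/setP=> u; rewrite !inE; case: (u \in S) (u == z) (h z u) => [] [] [].
by rewrite addnC.
Qed.

Lemma far_sub S z : far S z \subset S.
Proof. by apply/subsetP=> u; rewrite inE => /andP[]. Qed.

Lemma triangle_freeW S S' : S' \subset S -> triangle_free S -> triangle_free S'.
Proof. by move=> /subsetP sS tf u v w uS vS wS; apply: tf; exact: sS. Qed.

Lemma stable_nbh S z : triangle_free S -> z \in S -> stable (nbh S z).
Proof.
move=> tf zS u v; rewrite !inE => /andP[uS zu] /andP[vS zv].
by apply: (tf u z v) => //; rewrite hS.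
Qed.

Lemma has_stable_nbh S z : triangle_free S -> z \in S ->
  has_stable S #|nbh S z|.
Proof.
move=> tf zS; exists (nbh S z); last by split=> //; apply: stable_nbh.
by apply/subsetP=> u; rewrite inE => /andP[].
Qed.

Lemma has_stableW S m n : m <= n -> has_stable S n -> has_stable S m.
Proof. by move=> mn [A sA [stA cA]]; exists A => //; split=> //; lia. Qed.

(** Nothing in [far S z] is related to [z], so [z] can be added to any stable set found there. *)
Lemma has_stable_far S z m : z \in S -> has_stable (far S z) m ->
  has_stable S m.+1.
Proof.
move=> zS [A /subsetP sA [stA cA]]; exists (z |: A).
  apply/subsetP=> u /setU1P[-> //|/sA].
  by rewrite inE => /andP[].
have farA u : u \in A -> ~~ h z u by move=> /sA; rewrite !inE => /and3P[].
split; last first.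
  rewrite cardsU1; suff -> : z \notin A by lia.
  by apply/negP=> /sA; rewrite !inE eqxx andbF.
move=> u v /setU1P[->|uA] /setU1P[->|vA]; first by rewrite hI.
- exact: farA.
- by rewrite hS farA.
- exact: stA.
Qed.

Lemma has_stable1 S : 0 < #|S| -> has_stable S 1.
Proof.
case/card_gt0P=> z zS; exists [set z]; first by rewrite sub1set.
by rewrite cards1; split=> // u v /set1P-> /set1P->; rewrite hI.
Qed.

Lemma has_stable2 S : triangle_free S -> 2 < #|S| -> has_stable S 2.
Proof.
move=> tf c; have /card_gt0P[z zS] : 0 < #|S| by lia.
have := card_nbh_far zS; case: (leqP 2 #|nbh S z|) => [le2 _|lt2 e].
  exact: has_stableW le2 (has_stable_nbh tf zS).
by apply: (has_stable_far zS); apply: has_stable1; lia.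
Qed.

Lemma has_stable3_far S z : triangle_free S -> z \in S -> 2 < #|far S z| ->
  has_stable S 3.
Proof.
move=> tf zS c; apply: (has_stable_far zS); apply: has_stable2 => //.
exact: triangle_freeW (far_sub S z) tf.
Qed.

(** This is the Ramsey bound R(3,3) = 6: either [z] has three neighbours, a stable set by
    triangle-freeness, or at least three far vertices, which contain a stable pair to be joined with
    [z]. *)
Lemma has_stable3 S : triangle_free S -> 5 < #|S| -> has_stable S 3.
Proof.
move=> tf c; have /card_gt0P[z zS] : 0 < #|S| by lia.
have := card_nbh_far zS; case: (leqP 3 #|nbh S z|) => [le3 _|lt3 e].
  exact: has_stableW le3 (has_stable_nbh tf zS).
by apply: (has_stable3_far tf zS); lia.
Qed.

Lemma card_nbhU S A B z : S = A :|: B -> [disjoint A & B] ->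
  #|nbh S z| = #|nbh A z| + #|nbh B z|.
Proof.
move=> -> dAB; have -> : nbh (A :|: B) z = nbh A z :|: nbh B z.
  by apply/setP=> u; rewrite !inE andb_orl.
rewrite cardsU; suff -> : nbh A z :&: nbh B z = set0 by rewrite cards0 subn0.
apply/setP=> u; rewrite !inE; case uA: (u \in A) => //=.
by rewrite (disjointFr dAB uA) andbF.
Qed.

Lemma double_count A B :
  \sum_(u in A) #|nbh B u| = \sum_(v in B) #|nbh A v|.
Proof.
have E C u : #|nbh C u| = \sum_(v in C) h u v.
  rewrite -sum1_card big_mkcond [RHS]big_mkcond /=.
  by apply: eq_bigr => v _; rewrite inE; case: (v \in C); case: (h u v).
under eq_bigr do rewrite E; under [RHS]eq_bigr do rewrite E.
rewrite exchange_big; apply: eq_bigr => u _; apply: eq_bigr => v _.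
by rewrite hS.
Qed.

(* Otherwise the far set of every z has exactly five elements and induces a
   5-cycle; every z has the same degree k, and counting the edges between
   [nbh S z] and [far S z] gives 5 (k - 2) = k (k - 1), which has no solution. *)
Lemma has_stable4 S : triangle_free S -> 0 < #|S| ->
  {in S, forall z, 4 < #|far S z|} -> has_stable S 4.
Proof.
move=> tf /card_gt0P[z zS] far5.
case: (boolP [exists u in S, 5 < #|far S u|]) => [/exists_inP[u uS c]|].
  apply: (has_stable_far uS); apply: has_stable3 => //.
  exact: triangle_freeW (far_sub S u) tf.
rewrite negb_exists_in => /forall_inP far5'.
have {far5'} far5 u : u \in S -> #|far S u| = 5.
  by move=> uS; have := far5 u uS; have := far5' u uS; lia.
set F := far S z; set N := nbh S z.
have tfF : triangle_free F by apply: triangle_freeW (far_sub S z) tf.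
have FS u : u \in F -> u \in S by apply/subsetP/far_sub.
(* As [F] has five elements, a vertex of [F] whose degree in [F] is not 2 has either three
   neighbours or three far vertices in [F]. Both give a stable triple in [F], which [z] extends. *)
case: (boolP [exists u in F, #|nbh F u| != 2]) => [/exists_inP[u uF c]|].
  apply: (has_stable_far zS); have := card_nbh_far uF.
  rewrite (far5 z zS); case: (leqP 3 #|nbh F u|) => [le3 _|lt3 e].
    exact: has_stableW le3 (has_stable_nbh tfF uF).
  by apply: (has_stable3_far tfF uF); lia.
rewrite negb_exists_in => /forall_inP deg2.
have degS u : u \in S -> #|nbh S u| = #|N|.
  move=> uS; have := card_nbh_far uS; have := card_nbh_far zS.
  by rewrite !far5 // -/N; lia.
have splitS : S :\ z = F :|: N.
  apply/setP=> u; rewrite !inE; case: (eqVneq u z) => [->|_] /=.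
    by rewrite hI !andbF.
  by case: (u \in S); case: (h z u).
have disFN : [disjoint F & N].
  rewrite -setI_eq0; apply/eqP/setP=> u; rewrite !inE.
  by case: (u \in S); case: (h z u); rewrite ?andbF.
have degD u : u \in S -> #|N| = h z u + (#|nbh F u| + #|nbh N u|).
  move=> uS; rewrite -(degS u uS) -(card_nbhU u splitS disFN).
  rewrite (cardsD1 z) !inE zS hS; congr (_ + #|pred_of_set _|).
  by apply/setP=> v; rewrite !inE andbA.
(* A vertex of [F] is not adjacent to [z] and spends two of its [#|N|] neighbours inside [F]. *)
have eF : \sum_(u in F) #|nbh N u| = 5 * (#|N| - 2).
  rewrite -(far5 z zS) -sum_nat_const; apply: eq_bigr => u uF.
  have := degD u (FS u uF); have := deg2 u uF; rewrite negbK => /eqP->.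
  by move: uF; rewrite !inE => /and3P[_ _ /negbTE->]; lia.
(* A vertex of [N] is adjacent to [z] and to nothing in the stable set [N]. *)
have eN : \sum_(v in N) #|nbh F v| = #|N| * (#|N| - 1).
  rewrite -sum_nat_const; apply: eq_bigr => v vN.
  have vS : v \in S by move: vN; rewrite inE => /andP[].
  have := degD v vS; have -> : nbh N v = set0.
    apply/setP=> w; rewrite [w \in nbh _ _]inE in_set0; case wN: (w \in N) => //=.
    by apply/negbTE/(stable_nbh tf zS).
  by move: vN; rewrite inE cards0 => /andP[_ ->]; lia.
have [u uF] : exists u, u \in F by apply/card_gt0P; rewrite far5.
(* Makes the truncated difference [#|N| - 2] exact. With k = [#|N|] the two counts then give (k -
   3)^2 + 1 = 0. *)
have N2 : 1 < #|N|.
  have := degD u (FS u uF); have := deg2 u uF; rewrite negbK => /eqP->; lia.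
by have := double_count F N; rewrite eF eN; nia.
Qed.

End TriangleFree.

(** * Colourings, cliques and claws *)

Lemma chromaticP (G : sgraph) : colorable G (chromatic G).
Proof. by rewrite /chromatic; case: ex_minnP. Qed.

Section Coloring.
Variable G : sgraph.
Implicit Types (A K : {set G}) (u v w x y z : G).

Definition clique K := {in K &, forall u v, u != v -> edge u v}.
Definition neighbors x := [set u | edge x u].
Definition common x y := neighbors x :&: neighbors y.

Lemma edge_neq x y : edge x y -> x != y.
Proof. by apply: contraTneq => ->; rewrite edge_irr. Qed.

Lemma chromatic_le k : colorable G k -> chromatic G <= k.
Proof. by rewrite /chromatic; case: ex_minnP => m _ /[apply]. Qed.

Lemma chromatic_leP k (c : G -> nat) : (forall x, c x < k) ->
  (forall x y, edge x y -> c x <> c y) -> chromatic G <= k.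
Proof.
move=> ck cP; apply: chromatic_le; apply/existsP.
exists [ffun x => Ordinal (ck x)]; apply/forallP=> x; apply/forallP=> y.
apply/implyP=> exy; rewrite !ffunE; apply/eqP=> /(congr1 val) /=.
exact: cP.
Qed.

(** An optimal colouring of [delete A] is extended to all of [G] by the default 0 on [A], where
    nothing is claimed. Recolouring arguments can then avoid the subset type. *)
Lemma delete_coloring A : exists c : G -> nat,
  (forall x, x \notin A -> c x < chromatic (delete A)) /\
  (forall x y, x \notin A -> y \notin A -> edge x y -> c x <> c y).
Proof.
have /existsP[c /forallP cP] := chromaticP (delete A).
pose d x : nat := if insub x is Some u then c u else 0.
have dE x (xA : x \in ~: A) : d x = c (Sub x xA) by rewrite /d insubT.
exists d; split=> [x xA|x y xA yA exy].
  by rewrite dE ?inE // ltn_ord.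
have xA' : x \in ~: A by rewrite inE.
have yA' : y \in ~: A by rewrite inE.
rewrite !dE => /val_inj ce; have /forallP := cP (Sub x xA').
by move=> /(_ (Sub y yA')) /implyP /(_ exy); rewrite ce eqxx.
Qed.

Lemma clique_delete A K : clique K -> [disjoint K & A] ->
  #|K| <= chromatic (delete A).
Proof.
move=> cK dKA; have [c [ck cP]] := delete_coloring A.
set k := chromatic _ in ck *.
have KA u : u \in K -> u \notin A by move=> uK; rewrite (disjointFr dKA uK).
(* Without colours every vertex lies in [A], so [K] is empty; otherwise the colours live in
   ['I_k.+1], as [inord] requires. *)
case: k ck => [|k] ck.
  rewrite leqn0 cards_eq0; apply/eqP/setP=> u; rewrite inE.
  by apply/negP=> /KA/ck.
have inj : {in K &, injective (fun u => inord (c u) : 'I_k.+1)}.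
  move=> u v uK vK /(congr1 val); rewrite /= !inordK ?ck ?KA // => cuv.
  apply/eqP; apply: contraT => uv.
  by case: (cP u v (KA _ uK) (KA _ vK) (cK u v uK vK uv)).
by rewrite -(card_in_imset inj) (leq_trans (max_card _)) ?card_ord.
Qed.

Lemma clique_setU1 K v : clique K -> {in K, forall u, edge v u} ->
  clique (v |: K).
Proof.
move=> cK vK u w /setU1P[->|uK] /setU1P[->|wK]; first by rewrite eqxx.
- by rewrite vK.
- by rewrite edge_sym vK.
- exact: cK.
Qed.

Lemma clique_isomorphic K : clique K -> #|K| = #|G| ->
  isomorphic G (complete #|G|).
Proof.
move=> cK KG; have KT : K = setT.
  by apply/eqP; rewrite eqEcard subsetT cardsT KG leqnn.
exists enum_rank.
  by exists enum_val; [exact: enum_rankK | exact: enum_valK].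
move=> x y; rewrite /= /complete_edge (inj_eq enum_rank_inj).
case: (eqVneq x y) => [->|xy]; first by rewrite edge_irr.
by rewrite cK // KT inE.
Qed.

(** Three pairwise distinct, nonadjacent neighbours of [x] would induce a claw with centre [x]. *)
Lemma claw_free_neighbors x (S : {set G}) : claw_free G ->
  S \subset neighbors x ->
  triangle_free (fun u v => (u != v) && ~~ edge u v) S.
Proof.
move=> cf /subsetP sS a b c aS bS cS /andP[ab nab] /andP[bc nbc].
apply/negP=> /andP[ac nac]; apply: cf.
have [xa xb xc] : [/\ edge x a, edge x b & edge x c].
  by split; [have := sS a aS | have := sS b bS | have := sS c cS]; rewrite inE.
exists [set x; a; b; c].
(* The centre [x] goes to the side of size 1, the leaves [a], [b], [c] to the three vertices of the
   other side. *)
pose f (u : induced [set x; a; b; c]) : biclique 1 3 :=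
  if val u == x then inl ord0 else
  if val u == a then inr (inord 0) else
  if val u == b then inr (inord 1) else inr (inord 2).
have [[nx na] nb] := (edge_neq xa, edge_neq xb, edge_neq xc).
have [fx fa fb fc] : [/\ forall p, f (exist _ x p) = inl ord0,
  forall p, f (exist _ a p) = inr (inord 0),
  forall p, f (exist _ b p) = inr (inord 1) &
  forall p, f (exist _ c p) = inr (inord 2)].
  rewrite /f /=; split=> p; rewrite ?eqxx //.
  - by rewrite eq_sym (negbTE nx).
  - by rewrite ![b == _]eq_sym (negbTE na) (negbTE ab).
  - by rewrite ![c == _]eq_sym (negbTE nb) (negbTE ac) (negbTE bc).
have inordE (i j : nat) : i < 3 -> j < 3 ->
    ((inr (inord i) : 'I_1 + 'I_3) == inr (inord j)) = (i == j).
  move=> i3 j3; apply/eqP/eqP=> [[] /(congr1 val)|-> //].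
  by rewrite /= !inordK.
(* Case analysis over the four vertices with arbitrary membership proofs, matching the form of [fx],
   [fa], [fb], [fc]. *)
have cases (P : induced [set x; a; b; c] -> Prop) :
    (forall p, P (exist _ x p)) -> (forall p, P (exist _ a p)) ->
    (forall p, P (exist _ b p)) -> (forall p, P (exist _ c p)) ->
    forall u : induced [set x; a; b; c], P u.
  move=> Px Pa Pb Pc [u up].
  by have := up; rewrite !inE -!orbA => /or4P[] /eqP ue; subst u.
exists f; last first.
  by elim/cases=> p; elim/cases=> q; rewrite ?fx ?fa ?fb ?fc /= /induced_edge /=;
    rewrite ?edge_irr // 1?edge_sym ?xa ?xb ?xc // ?(negbTE nab) ?(negbTE nbc)
      ?(negbTE nac) // edge_sym ?xa ?xb ?xc // ?(negbTE nab) ?(negbTE nbc)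
      ?(negbTE nac).
apply: inj_card_bij.
  elim/cases=> p; elim/cases=> q; rewrite ?fx ?fa ?fb ?fc => /eqP;
    rewrite ?inordE // => _; exact: val_inj.
rewrite card_sum !card_ord card_sig /= -[X in _ <= X]cardsE.
have -> : [set u | u \in [set x; a; b; c]] = x |: (a |: (b |: [set c])).
  by apply/setP=> u; rewrite !inE -!orbA; do 4 case: (u == _).
rewrite !cardsU1 !inE cards1.
by rewrite (negbTE nx) (negbTE na) (negbTE nb) (negbTE ab) (negbTE bc) (negbTE ac).
Qed.

End Coloring.

(** Pigeonhole in the form used for recolouring: too few vertices cannot carry all colours. *)
Lemma missing_color (T : finType) (S : {set T}) (c : T -> nat) k :
  #|S| < k -> exists2 i, i < k & {in S, forall u, c u <> i}.
Proof.
(* Values of [c] out of range become 0 under [inord]. This can only exclude a further colour, and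
   [I] still has at most [#|S|] elements. *)
case: k => // k Sk; pose I := [set (inord (c u) : 'I_k.+1) | u in S].
have /card_gt0P[i] : 0 < #|~: I|.
  rewrite cardsCs setCK card_ord subn_gt0 (leq_ltn_trans _ Sk) //.
  exact: leq_imset_card.
rewrite inE => /imsetP iI; exists i => // u uS cu; apply: iI; exists u => //.
by rewrite cu inord_val.
Qed.

(** * Recolouring arguments in critical graphs *)

Section Critical.
Variable G : sgraph.
Implicit Types (A K : {set G}) (u v w x y z : G).

(** With fewer neighbours, [x] could take a colour of [delete [set x]] absent from them, and its
    removal would not lower the chromatic number. *)
Lemma critical_degree x : critical G -> chromatic G <= #|neighbors x| + 1.
Proof.
move=> /(_ x); have [c [ck cP]] := delete_coloring [set x].
set k := chromatic (delete _) in ck * => chiG; rewrite -chiG leq_add2r leqNgt.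
apply/negP=> /(missing_color c) [i ik iN].
suff : chromatic G <= k by lia.
apply: (@chromatic_leP _ _ (fun u => if u == x then i else c u)) => [u|u v uv].
  by case: eqVneq => // ux; apply: ck; rewrite inE.
case: (eqVneq u x) (eqVneq v x) => [ux|ux] [vx|vx].
- by move: uv; rewrite ux vx edge_irr.
- by apply/nesym/iN; rewrite inE -ux.
- by apply/iN; rewrite inE -vx edge_sym.
- by apply: cP => //; rewrite inE.
Qed.

(* A colour class without a common neighbour of the triangle could be
   distributed among the colours of x, y and z. *)
Lemma critical_triangle x y z : edge x y -> edge y z -> edge x z ->
  chromatic (delete [set x; y; z]) + 3 = chromatic G ->
  chromatic G <= #|common x y :&: neighbors z| + 3.
Proof.
move=> xy yz xz; have [c [ck cP]] := delete_coloring [set x; y; z].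
set k := chromatic (delete _) in ck * => chiG; rewrite -chiG leq_add2r leqNgt.
apply/negP=> /(missing_color c) [i ik iN].
suff : chromatic G <= k.+2 by lia.
(* The vertices [x], [y], [z] get [i] and the fresh colours [k] and [k.+1], so k + 2 colours
   suffice. Each vertex of class [i] takes the colour of a triangle vertex not adjacent to it; one
   exists because [i] misses the common neighbours. *)
pose d u := if ~~ edge u x then i else if ~~ edge u y then k else k.+1.
pose c' u := if u == x then i else if u == y then k else
  if u == z then k.+1 else if c u == i then d u else c u.
have dP u : c u = i -> [/\ edge u x -> d u <> i, edge u y -> d u <> k &
    edge u z -> d u <> k.+1].
  move=> cu; rewrite /d; split=> [->|uy|uz] /=.
  - by case: ifP => _; lia.
  - by rewrite uy; case: ifP => _ /=; lia.
  - case: ifP => [_|/negbFE ux]; first lia.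
    case: ifP => [_|/negbFE uy]; first lia.
    by case: (iN u) => //; rewrite !inE ![edge _ u]edge_sym ux uy uz.
have dC u v : edge u v -> c u = i -> c v <> i -> c v < k -> d u <> c v.
  by rewrite /d => uv cu cv cvk; do 2 (case: ifP => _; try lia).
apply: (@chromatic_leP _ _ c') => [u|u v]; rewrite /c'.
  case: (eqVneq u x) => [_|ux]; first lia.
  case: (eqVneq u y) => [_|uy]; first lia.
  case: (eqVneq u z) => [_|uz]; first lia.
  have := ck u; rewrite !inE (negbTE ux) (negbTE uy) (negbTE uz) => /(_ isT).
  by rewrite /d; do 3 (case: ifP => _; try lia).
(* Edges with exactly one end in the triangle, here [a]. *)
have sep a b : edge a b -> b != x -> b != y -> b != z ->
    (a == x) || (a == y) || (a == z) -> c' a <> c' b.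
  move=> ab bx by_ bz; rewrite /c' (negbTE bx) (negbTE by_) (negbTE bz).
  have bT : c b < k by apply: ck; rewrite !inE (negbTE bx) (negbTE by_).
  have ba : edge b a by rewrite edge_sym.
  case: (eqVneq a x) => [ax _|ax].
    case: eqP => cb; last lia.
    by have [D _ _] := dP b cb; apply/nesym/D; rewrite -ax.
  case: (eqVneq a y) => [ay _|ay].
    case: eqP => cb; last lia.
    by have [_ D _] := dP b cb; apply/nesym/D; rewrite -ay.
  case: (eqVneq a z) => [az _|//].
  case: eqP => cb; last lia.
  by have [_ _ D] := dP b cb; apply/nesym/D; rewrite -az.
move=> uv; have vu : edge v u by rewrite edge_sym.
rewrite -/(c' u) -/(c' v).
have [uT|uT] := boolP (u \in [set x; y; z]);
  have [vT|vT] := boolP (v \in [set x; y; z]).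
- have [yx [zx zy]] : y != x /\ z != x /\ z != y.
    by rewrite ![_ == x]eq_sym [z == y]eq_sym !edge_neq.
  move: uT vT uv; rewrite /c' !inE -!orbA.
  by case/or3P=> /eqP-> /or3P[] /eqP->; rewrite ?edge_irr // ?eqxx
    ?(negbTE yx) ?(negbTE zx) ?(negbTE zy) ?eqxx => _; lia.
- by move: uT vT; rewrite !inE !negb_or -!andbA => uT /and3P[*]; apply: sep.
- move: uT vT; rewrite !inE !negb_or -!andbA => /and3P[ux uy uz] vT.
  by apply/nesym/sep.
- have [cu cv] := (ck u uT, ck v vT); have cuv := cP u v uT vT uv.
  move: uT vT; rewrite /c' !inE !negb_or -!andbA.
  move=> /and3P[/negbTE-> /negbTE-> /negbTE->] /and3P[/negbTE-> /negbTE-> /negbTE->].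
  case: eqP => cui; case: eqP => cvi //; first by rewrite -cvi in cui.
    exact: dC.
  by apply/nesym/dC.
Qed.

(** Deleting a vertex outside [K] would keep the clique, so the chromatic number could not drop. *)
Lemma critical_clique K : critical G -> clique K -> chromatic G <= #|K| ->
  K = setT.
Proof.
move=> cr cK chiK; apply/setP=> u; rewrite inE; apply: contraT => uK.
have := clique_delete cK (A := [set u]); rewrite disjoint_sym disjoints1.
by move=> /(_ uK); have := cr u; lia.
Qed.

(** * Triangle-critical claw-free graphs of chromatic number 8 *)

Hypothesis crit : triangle_critical G.
Hypothesis cf : claw_free G.
Hypothesis chi8 : chromatic G = 8.

Let nonedge : rel G := fun u v => (u != v) && ~~ edge u v.

(** Transfers the condition on embeddings of [complete 3] to three explicit vertices; the value is 8
    - 3. *)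
Lemma delete_triangle x y z : edge x y -> edge y z -> edge x z ->
  chromatic (delete [set x; y; z]) = 5.
Proof.
move=> xy yz xz; have [_ _ cr] := crit.
pose f (i : complete 3) : G := nth x [:: x; y; z] i.
have fE : f @: [set: complete 3] = [set x; y; z].
  apply/setP=> u; rewrite !inE -orbA; apply/imsetP/or3P=> [[i _ ->]|].
    by case: i => [[|[|[|//]]] lti]; rewrite /f /= eqxx;
      [constructor 1 | constructor 2 | constructor 3].
  by case=> /eqP->; [exists (inord 0 : 'I_3) | exists (inord 1 : 'I_3)
    | exists (inord 2 : 'I_3)]; rewrite // /f inordK.
have ef : forall i j : complete 3, edge i j -> edge (f i) (f j).
  by case=> [[|[|[|//]]] ?] [[|[|[|//]]] ?]; rewrite /= /complete_edge // /f /= =>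
    _; rewrite // edge_sym.
have /cr : embedding f.
  split=> // i j fij; apply/eqP; apply: contraT => ij.
  by have := ef i j ij; rewrite fij edge_irr.
by rewrite fE chi8; lia.
Qed.

Lemma triangle_common x y z : edge x y -> edge y z -> edge x z ->
  4 < #|common x y :&: neighbors z|.
Proof.
move=> xy yz xz; have := critical_triangle xy yz xz.
by rewrite delete_triangle // chi8 => /(_ erefl); lia.
Qed.

(** The five common neighbours of the triangle and [z] itself are all common neighbours of [x] and
    [y]. *)
Lemma edge_common x y z : edge x y -> edge y z -> edge x z ->
  5 < #|common x y|.
Proof.
move=> xy yz xz; have := triangle_common xy yz xz.
rewrite (cardsD1 z (common x y)) !inE xz yz /= => /leq_trans; apply.
apply: subset_leq_card; apply/subsetP=> u; rewrite !inE => /andP[-> zu].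
by rewrite eq_sym (edge_neq zu).
Qed.

Lemma exists_clique6 : exists2 K : {set G}, clique K & 5 < #|K|.
Proof.
have [[f [_ ef]] _ _] := crit.
have e i j : i != j -> edge (f i) (f j) by move=> ij; apply: ef.
pose x := f (inord 0 : 'I_3); pose y := f (inord 1 : 'I_3).
pose z := f (inord 2 : 'I_3).
have [xy yz xz] : [/\ edge x y, edge y z & edge x z].
  by split; apply: e; apply/eqP=> /(congr1 val); rewrite /= !inordK.
have nS : symmetric nonedge.
  by move=> u v; rewrite /nonedge eq_sym edge_sym.
have nI : irreflexive nonedge by move=> u; rewrite /nonedge eqxx.
(* A set stable for [nonedge] is a clique, so this yields the K_4 inside [common x y]. *)
have [||w|A /subsetP sA [stA cA]] := has_stable4 nS nI (S := common x y).
- exact: claw_free_neighbors cf (subsetIl _ _).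
- by apply/card_gt0P; exists z; rewrite !inE xz yz.
(* For [nonedge], the far vertices of [w] are its neighbours in [G], and the triangle [x], [y], [w]
   supplies five of them in [common x y]. *)
- rewrite !inE => /andP[xw yw]; have := triangle_common xy yw xw.
  move=> /leq_trans; apply; apply: subset_leq_card; apply/subsetP=> u.
  rewrite !inE => /andP[-> wu]; rewrite /nonedge negb_and negbK wu orbT andbT.
  by rewrite eq_sym (edge_neq wu).
have cliqueA : clique A.
  by move=> u v uA vA uv; have := stA u v uA vA; rewrite /nonedge uv negbK.
have xA u : u \in A -> edge x u /\ edge y u.
  by move=> /sA; rewrite !inE => /andP[].
exists (x |: (y |: A)).
  apply: clique_setU1 => [|u /setU1P[-> //|/xA[]//]].
  by apply: clique_setU1 => // u /xA[].
have yNA : y \notin A by apply/negP=> /xA[_]; rewrite edge_irr.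
have xNA : x \notin y |: A.
  by apply/negP=> /setU1P[xy'|/xA[]]; [move: xy; rewrite xy'|]; rewrite edge_irr.
by rewrite !cardsU1 xNA yNA; lia.
Qed.

Lemma clique6_complete K : clique K -> #|K| = 6 ->
  exists2 K' : {set G}, clique K' & #|K'| = 8.
Proof.
move=> cK K6; have [_ cr _] := crit.
have tfree x y z : x \notin K -> y \notin K -> z \notin K ->
    edge x y -> edge y z -> edge x z -> False.
  move=> xK yK zK xy yz xz; have := clique_delete cK (A := [set x; y; z]).
  rewrite delete_triangle // K6 => /(_ _)/negP; apply=> //.
  rewrite -setI_eq0; apply/eqP/setP=> u; rewrite !inE -orbA.
  by apply: contraTF isT => /andP[uK /or3P[] /eqP ue]; move: uK;
    rewrite ue ?(negbTE xK) ?(negbTE yK) ?(negbTE zK).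
have out2 v : v \notin K -> 4 < #|neighbors v :&: K|.
  move=> vK; have := critical_degree v cr; rewrite chi8.
  rewrite -(cardsID K (neighbors v)).
  suff : #|neighbors v :\: K| <= 2 by lia.
  rewrite leqNgt; apply/negP=> /card_gt2P[a [b [c]]].
  have oP u : u \in neighbors v :\: K -> u \notin K /\ edge v u.
    by rewrite !inE => /andP[].
  have sN : neighbors v :\: K \subset neighbors v by apply: subsetDl.
  move=> [[aN bN cN] [ab bc ca]].
  have ne u w : u \in neighbors v :\: K -> w \in neighbors v :\: K ->
      u != w -> nonedge u w.
    move=> uN wN uw; rewrite /nonedge uw; apply/negP=> euw.
    have [[uK vu] [wK vw]] := (oP u uN, oP w wN).
    exact: (tfree v u w).
  have /negP := claw_free_neighbors cf sN aN bN cN (ne _ _ aN bN ab)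
    (ne _ _ bN cN bc).
  by apply; apply: ne => //; rewrite eq_sym.
case: (boolP [exists v, exists p, [&& v \notin K, p \notin K & edge v p]]).
  case/existsP=> v /existsP[p /and3P[vK pK vp]].
  (* Two subsets of the six vertices of [K], each of size at least 5, must meet. *)
  have /card_gt0P[u] : 0 < #|(neighbors v :&: K) :&: (neighbors p :&: K)|.
    have := cardsUI (neighbors v :&: K) (neighbors p :&: K).
    have : #|(neighbors v :&: K) :|: (neighbors p :&: K)| <= 6.
      by rewrite -K6 subset_leq_card // subUset !subsetIr.
    by have := out2 v vK; have := out2 p pK; lia.
  rewrite !inE => /andP[/andP[vu _] /andP[pu _]].
  (* A common neighbour outside [K] would close a triangle there, so the at least six common
     neighbours fill [K]. *)
  have KE : common v p = K.
    apply/eqP; rewrite eqEcard K6 (edge_common vp pu vu) andbT.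
    apply/subsetP=> w; rewrite !inE => /andP[vw pw]; apply: contraT => wK.
    by case: (tfree v p w).
  have Kvp w : w \in K -> edge v w /\ edge p w by rewrite -KE !inE => /andP.
  exists (v |: (p |: K)).
    apply: clique_setU1 => [|w /setU1P[-> //|/Kvp[]//]].
    by apply: clique_setU1 => // w /Kvp[].
  by rewrite !cardsU1 pK !inE negb_or vK K6 edge_neq.
rewrite negb_exists => /forallP indep; exfalso.
suff : chromatic G <= 7 by rewrite chi8.
(* The vertices of [K] get the colours 0 to 5. Every vertex outside [K] gets the default index 6,
   which is proper since no edge lies outside [K]. *)
apply: (@chromatic_leP _ _ (fun u => index u (enum K))) => [u|u v uv].
  by rewrite ltnS (leq_trans (index_size _ _)) // -cardE K6.
case: (boolP (u \in K)) => uK; last first.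
  case: (boolP (v \in K)) => vK.
    rewrite (memNindex (s := enum K)) ?mem_enum // => e.
    by have := vK; rewrite -mem_enum -index_mem -e ltnn.
  have := indep u; rewrite negb_exists => /forallP /(_ v).
  by rewrite uK vK uv.
move=> e; have := uv; suff -> : u = v by rewrite edge_irr.
have vK : v \in enum K by rewrite -index_mem -e index_mem mem_enum.
by rewrite -(nth_index u vK) -e nth_index // mem_enum.
Qed.

End Critical.

Theorem theorem10 (G : sgraph) (crit : triangle_critical G)
    (clawfree : claw_free G) (chi8 : chromatic G = 8) :
  isomorphic G (complete 8).
Proof.
have [K cK K6] := exists_clique6 crit clawfree chi8.
(* The clique is trimmed to exactly six vertices, the size [clique6_complete] asks for. *)
have [A sAK A6] : exists2 A : {set G}, A \subset K & #|A| = 6.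
  by have /card_geqP[s [us ss sK]] := K6; exists [set u in s];
    [apply/subsetP=> u; rewrite inE; apply: sK
    |rewrite cardsE (card_uniqP us)].
have cA : clique A by move=> u v /(subsetP sAK) uK /(subsetP sAK); apply: cK.
have [B cB B8] := clique6_complete crit clawfree chi8 cA A6.
have BT : B = setT.
  by case: crit => _ cr _; apply: critical_clique cr cB _; rewrite chi8 B8.
have G8 : #|G| = 8 by rewrite -B8 BT cardsT.
by rewrite -G8; apply: (clique_isomorphic cB); rewrite G8.
Qed.
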